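(* Let $m,n\ge1$ be integers. If $\tau,\tau'$ are two different triangulations of $Q_{K_{m,n}}$, then the maps $\phi_\tau$ and $\phi_{\tau'}$ are different.
   Context: Let $[m]=\{1,\dots,m\}$ and let $[\bar n]=\{\bar 1,\dots,\bar n\}$ be a disjoint set of $n$ symbols. $K_{m,n}$ is the complete bipartite graph with vertex set $[m]\cup[\bar n]$ and edges $(i,\bar j)$; subgraphs are identified with edge sets. Let $e_1,\dots,e_m,e_{\bar1},\dots,e_{\bar n}$ be the standard basis of $\mathbb{R}^{m+n}$. For $F\subset K_{m,n}$ let $\Delta_F$ be the convex hull of $e_i-e_{\bar j}$, $(i,\bar j)\in F$; $Q_{K_{m,n}}:=\Delta_{K_{m,n}}$ (a product of two simplices). A forest is a set of edges with no cycle. A triangulation $\tau$ of $Q_{K_{m,n}}$ is a simplicial complex each of whose simplices is $\Delta_F$ for a forest $F\subset K_{m,n}$, with $\Delta_F\cap\Delta_{F'}=\Delta_{F\cap F'}$ for any two of its simplices, and with union $Q_{K_{m,n}}$. $\mathcal{T}(\tau)$ is the set of spanning trees $T$ of $K_{m,n}$ with $\Delta_T\in\tau$. For a spanning tree $T$ put $\mathrm{LD}^-(T)=(\deg_i(T)-1)_{i\in[m]}$ and $\mathrm{RD}^-(T)=(\deg_{\bar j}(T)-1)_{\bar j\in[\bar n]}$. Let $\Delta^{\mathbb Z}(m,k)$ be the set of vectors in $\mathbb{Z}_{\ge0}^m$ with coordinate sum $k$. It is known (Postnikov) that for every triangulation $\tau$, $\mathrm{LD}^-:\mathcal{T}(\tau)\to\Delta^{\mathbb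 Z}(m,n-1)$ and $\mathrm{RD}^-:\mathcal{T}(\tau)\to\Delta^{\mathbb Z}(n,m-1)$ are bijections. The bijection $\phi_\tau:\Delta^{\mathbb Z}(m,n-1)\to\Delta^{\mathbb Z}(n,m-1)$ is defined by $\phi_\tau(\mathrm{LD}^-(T))=\mathrm{RD}^-(T)$ for $T\in\mathcal{T}(\tau)$. *)

(* Defs.v *)
From HB Require Import structures.
From mathcomp Require Import all_boot all_order all_algebra.
From mathcomp Require Import boolp classical_sets reals.

Set Implicit Arguments.
Unset Strict Implicit.
Unset Printing Implicit Defensive.

Import Order.TTheory GRing.Theory Num.Theory.
Local Open Scope classical_set_scope.
Local Open Scope ring_scope.

(* K_{m,n} has vertex type 'I_m + 'I_n (inl = left, inr = right); a subgraph
   is its edge set, the pair (i, j) standing for the edge {inl i, inr j}. *)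
Definition bigraph (m n : nat) := {set 'I_m * 'I_n}.

Definition adj (m n : nat) (F : bigraph m n) : rel ('I_m + 'I_n) :=
  fun u v => match u, v with
             | inl i, inr j => (i, j) \in F
             | inr j, inl i => (i, j) \in F
             | _, _ => false
             end.

(* A [ucycle] of size at most 2 is empty or runs back and forth along a single
   edge, hence is not a graph cycle. *)
Definition forest (m n : nat) (F : bigraph m n) : Prop :=
  forall p : seq ('I_m + 'I_n), ucycle (adj F) p -> (size p <= 2)%N.

Definition spanning_tree (m n : nat) (T : bigraph m n) : Prop :=
  forest T /\ forall u v : 'I_m + 'I_n, connect (adj T) u v.

Definition root_vector (R : realType) (m n : nat) (e : 'I_m * 'I_n) :
    'rV[R]_(m + n) :=
  delta_mx 0 (lshift n e.1) - delta_mx 0 (rshift m e.2).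

(* Convex hull of the root vectors of the edges of F; empty when F is. *)
Definition Delta (R : realType) (m n : nat) (F : bigraph m n) :
    set 'rV[R]_(m + n) :=
  [set x | exists w : 'I_m * 'I_n -> R,
     [/\ forall e, e \in F -> 0 <= w e,
         \sum_(e in F) w e = 1 &
         x = \sum_(e in F) w e *: root_vector R e]].
Arguments Delta R {m n} F.

Definition root_polytope (R : realType) (m n : nat) : set 'rV[R]_(m + n) :=
  Delta R [set: 'I_m * 'I_n]%SET.
Arguments root_polytope R m n : clear implicits.

(* The points root_vector e are vertices of the root polytope, so Delta F
   determines F and the faces of the simplex Delta F are the Delta F' with F' a
   subset of F.  The empty face is included, so every triangulation contains
   Delta set0 = set0. *)
Record triangulation (R : realType) (m n : nat)
    (tau : set (set 'rV[R]_(m + n))) : Prop := Triangulation {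
  tri_forest : forall s, tau s ->
    exists2 F : bigraph m n, forest F & s = Delta R F;
  tri_face : forall F F' : bigraph m n,
    tau (Delta R F) -> F' \subset F -> tau (Delta R F');
  tri_inter : forall F F' : bigraph m n,
    tau (Delta R F) -> tau (Delta R F') ->
    Delta R F `&` Delta R F' = Delta R (F :&: F')%SET;
  tri_cover : \bigcup_(s in tau) s = root_polytope R m n
}.

Definition trees (R : realType) (m n : nat) (tau : set (set 'rV[R]_(m + n))) :
    set (bigraph m n) :=
  [set T | spanning_tree T /\ tau (Delta R T)].

Definition ldeg (m n : nat) (F : bigraph m n) (i : 'I_m) : nat :=
  #|[set j : 'I_n | (i, j) \in F]|.

Definition rdeg (m n : nat) (F : bigraph m n) (j : 'I_n) : nat :=
  #|[set i : 'I_m | (i, j) \in F]|.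

(* When m, n > 0 all degrees in a spanning tree are positive, so the
   predecessor on nat does not truncate. *)
Definition LD (m n : nat) (T : bigraph m n) : {ffun 'I_m -> nat} :=
  [ffun i => (ldeg T i).-1].

Definition RD (m n : nat) (T : bigraph m n) : {ffun 'I_n -> nat} :=
  [ffun j => (rdeg T j).-1].

Definition lattice_simplex (m k : nat) :=
  {v : {ffun 'I_m -> nat} | (\sum_i v i == k)%N}.

Definition corner_vector (m k : nat) (m_gt0 : (0 < m)%N) :
    {ffun 'I_m -> nat} :=
  [ffun i => if i == Ordinal m_gt0 then k else 0%N].

Lemma corner_vector_sum (m k : nat) (m_gt0 : (0 < m)%N) :
  (\sum_i corner_vector k m_gt0 i == k)%N.
Proof.
rewrite (bigD1 (Ordinal m_gt0)) //= big1 ?addn0; first by rewrite ffunE eqxx.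
by move=> i /negPf ni; rewrite ffunE ni.
Qed.

Definition corner (m k : nat) (m_gt0 : (0 < m)%N) : lattice_simplex m k :=
  exist _ (corner_vector k m_gt0) (corner_vector_sum k m_gt0).

(* phi tau v is the w with v = LD T and w = RD T for some T in trees tau.  For
   a triangulation tau this w exists and is unique for each v, by Postnikov's
   theorem, so the default value [corner] is not used. *)
Definition phi (R : realType) (m n : nat) (n_gt0 : (0 < n)%N)
    (tau : set (set 'rV[R]_(m + n))) (v : lattice_simplex m n.-1) :
    lattice_simplex n m.-1 :=
  xget (corner m.-1 n_gt0)
    [set w | exists T : bigraph m n,
       [/\ trees tau T, LD T = val v & RD T = val w]].

(* Main.v *)
Require Import Defs.
From mathcomp Require Import boolp classical_sets reals.
From mathcomp Require Import all_boot all_order all_algebra.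
From mathcomp Require Import zify.

(** The geometry of a triangulation enters through one property of the family K
    of forests F whose simplex belongs to it.  Two vectors a and b of natural
    numbers with the same sum are the row and column sums of exactly one matrix
    of natural numbers whose support lies in K (the record [unimodular]).  Such
    a matrix exists because the simplices cover the root polytope: the point
    with coordinates proportional to (a, -b) has real weights on the edges of a
    forest, and they are integers after scaling, since the weight of an edge e
    is the difference of a and b over the left side of the cut made by deleting
    e ([cut_flow]).  It is unique because simplices meet in common faces.
    Everything else is combinatorics of K, carried out for the trees of K that
    span vertex sets I and J, so that vertices can be deleted.

    A tree of K is determined by its left degrees ([tree_degl_inj]): for each
    left vertex r, the edges with r on their left side form a matching of J,
    whose row sums are read off from the degrees of the tree, and the tree is
    the union of these matchings.  Every admissible vector v of left degrees
    minus one occurs ([tree_with_degl]): for m = #|I|, the margins (m v + 1, m)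
    admit no balanced proper part, so their matrix is supported on a spanning
    tree, and the cut inequalities force its left degrees to be v + 1.
    Exchanging the two sides gives both facts for right degrees.

    The heart of the proof is the behaviour of a right leaf j.  A tree T of K on
    (I, J), with j outside J, extends to a tree T + (i, j) of K for exactly one
    i, and by the above i is a function of the vector u of left degrees of T.
    It is monotone: if j is attached at i for u, it is still attached at i for
    u + e_i - e_k ([attach_unique]).  Now let K and K' have the same pairs of
    left and right degree vectors, and suppose that for the same u the leaf is
    attached at i in K and at k <> i in K'.  The tree of K' with left degrees
    u + e_k has a partner in K, which arises from some u2 by attaching j at i2,
    so u2 = u + e_k - e_i2.  Monotonicity in K' says that j is attached at k for
    u2, while it is attached at i2 <> k in K.  The disagreement persists and the
    k-th coordinate has grown, which cannot go on forever ([same_attach]).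

    Hence K and K' attach j at the same vertices, and after deletion of j they
    still have the same pairs of degree vectors.  As every tree has a leaf on
    one of the two sides, induction on the number of vertices shows that K and
    K' have the same trees ([degrees_determine_trees]).  Finally, each member of
    K lies in a spanning tree of K ([face_of_tree]), so the trees determine the
    triangulation, and the graph of phi consists of the pairs of degree vectors
    of the trees. *)

Set Implicit Arguments.
Unset Strict Implicit.
Unset Printing Implicit Defensive.

Import Order.TTheory GRing.Theory Num.Theory.

(** * Bipartite graphs and the cut of an edge *)

Lemma sum_mem (Z : finType) (A : {set Z}) : \sum_z (z \in A : nat) = #|A|.
Proof.
by rewrite -sum1_card [RHS]big_mkcond; apply: eq_bigr => z _; case: (z \in A).
Qed.

Section Graph.
Variables X Y : finType.
Implicit Types (F T : {set X * Y}) (e : X * Y) (u v x y z : X + Y).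
Implicit Types (I : {set X}) (J : {set Y}).

(** The relation [adj] over arbitrary finite types, so that the two sides can
    be exchanged. *)
Definition badj F : rel (X + Y) :=
  fun u v => match u, v with
             | inl i, inr j => (i, j) \in F
             | inr j, inl i => (i, j) \in F
             | _, _ => false
             end.

(** The component of the left end of e in F minus e. *)
Definition lside F e : pred (X + Y) := connect (badj (F :\ e)) (inl e.1).

(** Every edge is a bridge; this form of being a forest is the one that
    cuts use, and it passes to subgraphs and to added leaves at once. *)
Definition acyclic F := forall e, e \in F -> ~~ lside F e (inr e.2).

Definition verts I J : pred (X + Y) :=
  fun u => match u with inl i => i \in I | inr j => j \in J end.

Record tree I J T : Prop := Tree {
  tree_acyclic : acyclic T;
  tree_sub : forall e, e \in T -> (e.1 \in I) && (e.2 \in J);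
  tree_connected : {in verts I J &, forall u v, connect (badj T) u v} }.

Definition degl F i := #|[set j | (i, j) \in F]|.
Definition degr F j := #|[set i | (i, j) \in F]|.

Lemma badj_sym F : symmetric (badj F).
Proof. by case=> [i|j] [i'|j']. Qed.

Lemma badj_csym F : connect_sym (badj F).
Proof. exact/sym_connect_sym/badj_sym. Qed.

Lemma connect_subset F F' : F \subset F' ->
  subrel (connect (badj F)) (connect (badj F')).
Proof.
move=> /subsetP sFF'; apply: connect_sub => u v uv; apply: connect1.
by case: u v uv => [i|j] [i'|j'] //= /sFF'.
Qed.

Lemma acyclic_subset F F' : F \subset F' -> acyclic F' -> acyclic F.
Proof.
move=> sFF' acF' e eF; apply: contra (acF' e (subsetP sFF' e eF)).
by apply: connect_subset; rewrite setSD.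
Qed.

Lemma lside_left F e : lside F e (inl e.1).
Proof. exact: connect0. Qed.

Lemma lside_edge F e i j : (i, j) \in F -> (i, j) != e ->
  lside F e (inl i) = lside F e (inr j).
Proof.
move=> ijF ije; apply: same_connect_r; first exact: badj_csym.
by apply: connect1; rewrite /= !inE ije.
Qed.

(** An edge other than e has both ends on the same side of the cut, so its
    weight cancels from the two sums; the edge e contributes on the left only.
    In particular the margins determine the flow, and integral margins make it
    integral. *)
Lemma cut_flow (V : nmodType) F e (w : X * Y -> V) :
  acyclic F -> e \in F -> (forall e', e' \notin F -> w e' = 0%R) ->
  (\sum_(i | lside F e (inl i)) \sum_j w (i, j) =
   \sum_(j | lside F e (inr j)) \sum_i w (i, j) + w e)%R.
Proof.
move=> acF eF wF; rewrite big_mkcond [in RHS]big_mkcond /=.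
under eq_bigr => i _ do rewrite -mulrb -GRing.sumrMnl.
under [in RHS]eq_bigr => j _ do rewrite -mulrb -GRing.sumrMnl.
rewrite [in RHS]exchange_big !pair_bigA /= (bigD1 e) //= [in RHS](bigD1 e) //=.
case: e => i j in eF *; rewrite lside_left (negPf (acF _ eF)) mulr1n mulr0n.
rewrite add0r addrC; congr (_ + _)%R; apply: eq_bigr => -[i' j'] /= ne.
have [e'F|/wF ->] := boolP ((i', j') \in F); last by rewrite !mul0rn.
by rewrite (lside_edge e'F).
Qed.

Lemma path_avoid F e x z p : (x == inl e.1) || (x == inr e.2) ->
  x \notin z :: p -> path (badj F) z p ->
  connect (badj (F :\ e)) z (last z p).
Proof.
move=> xe xp zp; apply/connectP; exists p => //.
apply: (sub_in_path (P := predC1 x)) zp.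
  move=> [i|j] [i'|j'] //=; rewrite !inE => ne ne' ->; rewrite andbT.
    by apply: contraTneq xe => <-; rewrite negb_or /= ![x == _]eq_sym ne ne'.
  by apply: contraTneq xe => <-; rewrite negb_or /= ![x == _]eq_sym ne ne'.
by apply/allP => t tp /=; apply: contraNneq xp => <-.
Qed.

(** A simple path from x to y returns neither to x nor, after its first
    step, to any edge at x.  Thus deleting an edge at x separates x from y only
    if it is the first edge of the path. *)
Lemma first_step F x y : connect (badj F) x y -> y != x ->
  exists z, [/\ badj F x z,
    forall e, (x == inl e.1) || (x == inr e.2) -> connect (badj (F :\ e)) z y &
    forall e, (x == inl e.1) || (x == inr e.2) ->
      ~~ ((z == inl e.1) || (z == inr e.2)) -> connect (badj (F :\ e)) x y].
Proof.
case/connectP=> p0 xp0 ->; case/shortenP: xp0 => -[|z p] /= xp upx _.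
  by rewrite eqxx.
move=> _; exists z; case/andP: xp => xz zp; case/andP: upx => xNp _.
have zy e : (x == inl e.1) || (x == inr e.2) ->
  connect (badj (F :\ e)) z (last z p) by move=> xe; exact: path_avoid xe xNp zp.
split=> // e xe ze; apply: connect_trans (zy e xe); apply: connect1.
case: (x) (z) xz ze => [i|j] [i'|j'] //= ijF ne; rewrite !inE ijF andbT;
  by apply: contraNneq ne => <-; rewrite eqxx.
Qed.

Lemma degl_sum F i : degl F i = \sum_j ((i, j) \in F).
Proof.
by rewrite /degl -sum1dep_card big_mkcond; apply: eq_bigr => j _; case: ifP.
Qed.

Lemma degr_sum F j : degr F j = \sum_i ((i, j) \in F).
Proof.
by rewrite /degr -sum1dep_card big_mkcond; apply: eq_bigr => i _; case: ifP.
Qed.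

Lemma lside_right F e y : acyclic F -> e \in F ->
  connect (badj (F :\ e)) (inr e.2) y -> lside F e y = false.
Proof.
move=> acF eF jy; apply: contraNF (acF _ eF) => iy.
by apply: connect_trans iy _; rewrite badj_csym.
Qed.

(** Exactly one of the edges at i separates i from a given other vertex y:
    the first edge of the path from i to y. *)
Lemma lside_count_left I J T i y : tree I J T -> i \in I -> verts I J y ->
  \sum_j ((i, j) \in T) && lside T (i, j) y + (y != inl i) = degl T i.
Proof.
case=> acT sT cT iI yV; rewrite degl_sum; have [->|yi] := eqVneq y (inl i).
  by rewrite addn0; apply: eq_bigr => j _; rewrite (lside_left T (i, j)) andbT.
have [[i'|j0] [//= ij0 zy xy]] := first_step (cT (inl i) y iI yV) yi.
rewrite (bigD1 j0) //= [in RHS](bigD1 j0) //= ij0 lside_right //=; last first.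
  by apply: zy; rewrite eqxx.
rewrite add0n addnC; congr (_ + _); apply: eq_bigr => j jj0.
case ijT: ((i, j) \in T) => //=; rewrite /lside xy //= ?eqxx //.
by apply: contra jj0 => /eqP[->].
Qed.

Lemma lside_count_right I J T j y : tree I J T -> j \in J -> verts I J y ->
  \sum_i ((i, j) \in T) && lside T (i, j) y = (y != inr j).
Proof.
case=> acT sT cT jJ yV; have [->|yj] := eqVneq y (inr j).
  apply: big1 => i _; case ijT: (_ \in T) => //=.
  by rewrite (negPf (acT _ ijT)).
have [[i0|j'] [//= ij0 zy xy]] := first_step (cT (inr j) y jJ yV) yj.
rewrite (bigD1 i0) //= ij0 /lside zy ?eqxx ?orbT //= big1 ?addn0 // => i ii0.
case ijT: ((i, j) \in T) => //=; rewrite [connect _ _ _]lside_right //=.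
apply: xy; rewrite ?eqxx //= orbF.
by apply: contra ii0 => /eqP[->].
Qed.

Lemma sum_lside_left I J T i (Z : finType) (f : Z -> X + Y) (c : Z -> nat) :
  tree I J T -> i \in I -> (forall t, c t != 0 -> verts I J (f t)) ->
  \sum_(j | (i, j) \in T) \sum_(t | lside T (i, j) (f t)) c t =
  \sum_t c t * (degl T i - (f t != inl i)).
Proof.
move=> tT iI cV; rewrite (exchange_big_dep xpredT) //=; apply: eq_bigr => t _.
rewrite sum_nat_const mulnC; have [->//|/cV ft] := eqVneq (c t) 0.
rewrite -(lside_count_left tT iI ft) addnK -sum1_card big_mkcond /=.
by congr (_ * _); apply: eq_bigr => j _; rewrite -[j \in _]/(_ && _); case: (_ && _).
Qed.

Lemma sum_lside_right I J T j (Z : finType) (f : Z -> X + Y) (c : Z -> nat) :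
  tree I J T -> j \in J -> (forall t, c t != 0 -> verts I J (f t)) ->
  \sum_(i | (i, j) \in T) \sum_(t | lside T (i, j) (f t)) c t =
  \sum_t c t * (f t != inr j).
Proof.
move=> tT jJ cV; rewrite (exchange_big_dep xpredT) //=; apply: eq_bigr => t _.
rewrite sum_nat_const mulnC; have [->//|/cV ft] := eqVneq (c t) 0.
rewrite -(lside_count_right tT jJ ft) -sum1_card big_mkcond /=.
by congr (_ * _); apply: eq_bigr => i _; rewrite -[i \in _]/(_ && _); case: (_ && _).
Qed.

Lemma degl_gt0 I J T i : tree I J T -> i \in I -> J != set0 -> 0 < degl T i.
Proof.
move=> tT iI /set0Pn[j jJ].
by rewrite -(lside_count_left (y := inr j) tT iI jJ) addn1.
Qed.

(** Conversely to [cut_flow], the excess of a over b across each cut defines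
    a flow.  Summed over the edges at a vertex, the cuts count every other
    vertex a fixed number of times, so that the total excess -s and the value at
    the vertex itself are what remains.  With s = 0 the flow has margins a and
    b; with s = 1 it measures how far a exceeds the left degrees minus one. *)
Lemma flow_of_cuts I J T (a : X -> nat) (b : Y -> nat) s : tree I J T ->
  J != set0 -> (forall i, i \notin I -> a i = 0) ->
  (forall j, j \notin J -> b j = 0) -> \sum_i a i + s = \sum_j b j ->
  (forall e, e \in T -> \sum_(j | lside T e (inr j)) b j <=
                        \sum_(i | lside T e (inl i)) a i) ->
  exists w : X * Y -> nat, [/\ forall e, e \notin T -> w e = 0,
    forall i, i \in I -> \sum_j w (i, j) + s * (degl T i).-1 = a i &
    forall j, j \in J -> \sum_i w (i, j) + s = b j].
Proof.
move=> tT J0 aI bJ ab cut.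
have aV i : a i != 0 -> verts I J (inl i).
  by move=> ai; apply: contraNT ai => /aI ->.
have bV j : b j != 0 -> verts I J (inr j).
  by move=> bj; apply: contraNT bj => /bJ ->.
pose w e := if e \in T then \sum_(i | lside T e (inl i)) a i -
                             \sum_(j | lside T e (inr j)) b j else 0.
exists w; split=> [e|i iI|j jJ]; first by rewrite /w => /negPf ->.
  have EB := sum_lside_left tT iI bV; have EA := sum_lside_left tT iI aV.
  rewrite /= -big_distrl /= in EB.
  rewrite (bigD1 i) //= eqxx subn0 in EA.
  have {}EA : \sum_(j | (i, j) \in T) \sum_(t | lside T (i, j) (inl t)) a t =
      a i * degl T i + (\sum_(i' | i' != i) a i') * (degl T i - 1).
    rewrite EA big_distrl; congr (_ + _); apply: eq_bigr => i' i'i /=.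
    by rewrite (_ : (inl i' != _) = true) //; apply: contra i'i => /eqP[->].
  have : \sum_j w (i, j) + (\sum_j b j) * (degl T i - 1) =
        a i * degl T i + (\sum_(i' | i' != i) a i') * (degl T i - 1).
    rewrite -EA -EB /w -big_mkcond -big_split; apply: eq_bigr => j ijT /=.
    by rewrite subnK ?cut.
  rewrite -ab (bigD1 i) //= subn1.
  have := degl_gt0 tT iI J0; case: (degl T i) => //= d _; nia.
have EB := sum_lside_right tT jJ bV; have EA := sum_lside_right tT jJ aV.
rewrite (bigD1 j) //= eqxx muln0 add0n in EB.
have {}EB : \sum_(i | (i, j) \in T) \sum_(t | lside T (i, j) (inr t)) b t =
    \sum_(j' | j' != j) b j'.
  rewrite EB; apply: eq_bigr => j' j'j.
  by rewrite (_ : (inr j' != _) = true) ?muln1 //; apply: contra j'j => /eqP[->].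
have {}EA : \sum_(i | (i, j) \in T) \sum_(t | lside T (i, j) (inl t)) a t =
    \sum_i a i by rewrite EA; apply: eq_bigr => i _; rewrite muln1.
have : \sum_i w (i, j) + \sum_(j' | j' != j) b j' = \sum_i a i.
  rewrite -EA -EB /w -big_mkcond -big_split; apply: eq_bigr => i ijT /=.
  by rewrite subnK ?cut.
by move: ab; rewrite [in X in _ = X -> _](bigD1 j) //=; lia.
Qed.
End Graph.

(** * Leaves, matchings and the number of edges *)

Section Leaf.
Variables X Y : finType.
Implicit Types (F T : {set X * Y}) (e : X * Y) (u v : X + Y) (I : {set X}) (J : {set Y}).

Lemma tree_notin I J T i j : tree I J T -> j \notin J -> (i, j) \notin T.
Proof. by move=> tT; apply: contraNN => /(tree_sub tT) /andP[]. Qed.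

(** Contracting the leaf edge (i, j) maps paths to paths. *)
Lemma connect_leaf F i j u v : (forall x, (x, j) \notin F) ->
  connect (badj ((i, j) |: F)) u v ->
  let h t := if t == inr j then inl i else t in connect (badj F) (h u) (h v).
Proof.
move=> jF /connectP[p up ->] {v}; set h := fun t => _; cbv zeta.
elim: p u up => [|z p IHp] u /=; first by rewrite connect0.
case/andP=> uz /IHp; apply: connect_trans.
have hE x : h (inl x) = inl x by [].
have hR y : h (inr y) = if y == j then inl i else inr y.
  by rewrite /h (inj_eq inr_inj).
case: u z uz => [x|y] [x'|y'] //=; rewrite !inE xpair_eqE hE hR.
  have [->|_ xy] := eqVneq y' j.
    by rewrite (negPf (jF x)) andbT orbF => /eqP->.
  by apply: connect1; move: xy; rewrite andbF.
have [->|_ xy] := eqVneq y j.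
  by rewrite (negPf (jF x')) andbT orbF => /eqP->.
by apply: connect1; move: xy; rewrite andbF.
Qed.

Lemma tree_add_leaf I J T i j : tree I J T -> i \in I -> j \notin J ->
  tree I (j |: J) ((i, j) |: T).
Proof.
move=> tT iI jJ; have jT x := tree_notin x tT jJ; case: (tT) => acT sT cT.
split=> [e|e|u v].
- have [->|ne] := eqVneq e (i, j).
    rewrite /lside setU1K //= => _.
    apply/negP; rewrite badj_csym => /connectP[[|[x|y] p]] //=.
    by rewrite (negPf (jT x)).
  rewrite !inE (negPf ne) /= => eT; rewrite /lside.
  have -> : ((i, j) |: T) :\ e = (i, j) |: (T :\ e).
    by apply/setP => z; rewrite !inE; have [->|] := eqVneq z e; rewrite ?(negPf ne).
  apply: contra (acT e eT) => /(connect_leaf _) /=.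
  rewrite (inj_eq inr_inj) ifN; last first.
    by apply: contraNneq (jT e.1) => <-; rewrite -surjective_pairing.
  by apply=> x; rewrite !inE (negPf (jT x)) andbF.
- rewrite !inE => /orP[/eqP->|/sT/andP[-> ->]] /=; last by rewrite orbT.
  by rewrite iI eqxx.
- have toi t : t \in verts I (j |: J) ->
      connect (badj ((i, j) |: T)) t (inl i).
    have TT := @connect_subset _ _ _ _ (subsetUr [set (i, j)] T).
    case: t => [x|y]; rewrite unfold_in /=; first by move=> xI; apply/TT/cT.
    rewrite !inE => /orP[/eqP->|yJ]; last by apply/TT/cT.
    by apply: connect1; rewrite /= !inE eqxx.
  move=> /toi ui /toi vi; apply: connect_trans ui _.
  by rewrite badj_csym.
Qed.

Lemma tree_remove_leaf I J T j : tree I J T -> j \in J -> degr T j = 1 ->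
  exists i T1, [/\ i \in I, tree I (J :\ j) T1, T = (i, j) |: T1 &
                   j \notin J :\ j].
Proof.
move=> tT jJ /eqP/cards1P[i Ti]; case: (tT) => acT sT cT.
have iT x : ((x, j) \in T) = (x == i).
  by move/setP/(_ x): Ti; rewrite !inE.
have ijT : (i, j) \in T by rewrite iT.
have TE : T = (i, j) |: (T :\ (i, j)) by rewrite setD1K.
exists i, (T :\ (i, j)); split=> //; last by rewrite !inE eqxx.
  by have /andP[] := sT _ ijT.
split=> [||u v uV vV].
- exact: acyclic_subset (subD1set _ _) acT.
- move=> [x y]; rewrite !inE xpair_eqE => /andP[ne xyT].
  have /andP[/= -> ->] := sT _ xyT; rewrite andbT /=.
  by apply: contra ne => /eqP yj; move: xyT; rewrite yj iT eqxx andbT.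
have sV t : verts I (J :\ j) t -> verts I J t /\ t != inr j.
  case: t => [x|y] //=; rewrite !inE => /andP[yj ->]; split=> //.
have [[uJ uj] [vJ vj]] := (sV u uV, sV v vV).
have := cT u v uJ vJ; rewrite {1}TE => /(connect_leaf _) /=.
rewrite (negPf uj) (negPf vj); apply=> x; rewrite !inE xpair_eqE iT eqxx andbT.
by case: (x == i).
Qed.

Lemma degl_add_leaf F i j x : (forall x', (x', j) \notin F) ->
  degl ((i, j) |: F) x = degl F x + (x == i).
Proof.
move=> jF; rewrite !degl_sum (bigD1 j) //= [in RHS](bigD1 j) //= (negPf (jF x)).
rewrite !inE xpair_eqE eqxx andbT (negPf (jF x)) orbF add0n addnC.
by congr (_ + _); apply: eq_bigr => y yj; rewrite !inE xpair_eqE (negPf yj) andbF.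
Qed.

Lemma degr_add_leaf F i j y : (forall x', (x', j) \notin F) ->
  degr ((i, j) |: F) y = degr F y + (y == j).
Proof.
move=> jF; rewrite !degr_sum (bigD1 i) //= [in RHS](bigD1 i) //= !inE.
have E : \sum_(x | x != i) ((x, y) \in (i, j) |: F) =
         \sum_(x | x != i) ((x, y) \in F).
  by apply: eq_bigr => x xi; rewrite !inE xpair_eqE (negPf xi).
rewrite E addnAC; congr (_ + _); rewrite xpair_eqE eqxx /=.
by case: eqP => [->|_] /=; rewrite ?(negPf (jF i)) ?addn0.
Qed.

Lemma degl_eq0 I J T x : tree I J T -> x \notin I -> degl T x = 0.
Proof.
move=> tT xI; rewrite degl_sum big1 // => y _.
by case xyT: (_ \in T) => //; case/andP: (tree_sub tT xyT); rewrite (negPf xI).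
Qed.

Lemma degr_eq0 I J T y : tree I J T -> y \notin J -> degr T y = 0.
Proof.
move=> tT yJ; rewrite degr_sum big1 // => x _.
by case xyT: (_ \in T) => //; case/andP: (tree_sub tT xyT); rewrite (negPf yJ).
Qed.

(** The matching of the right vertices by their parents in T rooted at the
    left vertex r. *)
Definition matching T r e : nat := (e \in T) && lside T e (inl r).

Lemma matching0 T r e : e \notin T -> matching T r e = 0.
Proof. by rewrite /matching => /negPf->. Qed.

Lemma matching_row I J T r x : tree I J T -> r \in I ->
  \sum_y matching T r (x, y) + (x \in I) = degl T x + (x == r).
Proof.
move=> tT rI; have [xI|xI] := boolP (x \in I).
  rewrite -(lside_count_left (y := inl r) tT xI rI) -addnA; congr (_ + _).
  by rewrite (inj_eq inl_inj) eq_sym; case: eqP.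
rewrite (degl_eq0 tT xI) big1; first by case: eqP xI => [->|]; rewrite ?rI.
by move=> y _; rewrite matching0 //; apply: contra xI => /(tree_sub tT)/andP[].
Qed.

Lemma matching_col I J T r y : tree I J T -> r \in I ->
  \sum_x matching T r (x, y) = (y \in J).
Proof.
move=> tT rI; have [yJ|yJ] := boolP (y \in J).
  exact: (lside_count_right (y := inl r) tT yJ rI).
by rewrite big1 // => x _; rewrite matching0 // (tree_notin _ tT).
Qed.

(** Counting the matching rooted at r by rows and by columns. *)
Lemma edge_count I J T : tree I J T -> I != set0 ->
  \sum_x degl T x + 1 = #|I| + #|J|.
Proof.
move=> tT /set0Pn[r rI].
have: \sum_x (\sum_y matching T r (x, y) + (x \in I)) =
      \sum_x (degl T x + (x == r)).
  by apply: eq_bigr => x _; exact: matching_row tT rI.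
rewrite !big_split /= exchange_big /=.
under eq_bigr do rewrite (matching_col _ tT rI).
have -> : \sum_x (x == r : nat) = 1.
  by rewrite (bigD1 r) //= eqxx big1 // => x /negPf ->.
by rewrite !sum_mem addnC => ->.
Qed.
End Leaf.

(** * Exchange of the two sides *)

Section Swap.
Variables X Y : finType.
Definition swap (F : {set X * Y}) : {set Y * X} := [set e | (e.2, e.1) \in F].

Lemma degl_swap F j : degl (swap F) j = degr F j.
Proof. by rewrite degl_sum degr_sum; apply: eq_bigr => i _; rewrite inE. Qed.

Lemma degr_swap F i : degr (swap F) i = degl F i.
Proof. by rewrite degl_sum degr_sum; apply: eq_bigr => j _; rewrite inE. Qed.

Definition swap_vertex (u : Y + X) : X + Y :=
  match u with inl j => inr j | inr i => inl i end.

Lemma badj_swap F u v : badj (swap F) u v = badj F (swap_vertex u) (swap_vertex v).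
Proof. by case: u v => [j|i] [j'|i'] //=; rewrite inE. Qed.

End Swap.

Lemma swapK X Y : cancel (@swap X Y) (@swap Y X).
Proof. by move=> F; apply/setP => -[i j]; rewrite !inE. Qed.

Lemma connect_swap (X Y : finType) (F : {set X * Y}) u v :
  connect (badj F) (swap_vertex u) (swap_vertex v) -> connect (badj (swap F)) u v.
Proof.
case/connectP=> p; elim: p u => [|z p IHp] u /=.
  by case: u v => [j|i] [j'|i'] //= _ [->].
case/andP=> uz zp vE; set z' := swap_vertex z.
have zE : z = swap_vertex z' by rewrite /z'; case: (z).
apply: (connect_trans (y := z')); first by apply: connect1; rewrite badj_swap -zE.
by apply: IHp; rewrite -?zE.
Qed.

Lemma tree_swap (X Y : finType) (I : {set X}) (J : {set Y}) T :
  tree I J T -> tree J I (swap T).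
Proof.
case=> acT sT cT; split=> [[j i]|[j i]|u v uV vV].
- rewrite inE /= => eT; apply: contra (acT _ eT) => ji.
  rewrite /lside badj_csym /=.
  have -> : T :\ (i, j) = swap (swap T :\ (j, i)).
    by apply/setP => -[x y]; rewrite !inE !xpair_eqE [(y == j) && _]andbC.
  exact: (@connect_swap _ _ _ (inr j) (inl i)).
- by rewrite inE => /sT; rewrite andbC.
by apply: connect_swap; apply: cT; [case: u uV | case: v vV].
Qed.

(** * Unimodular complexes and their trees *)

Section Complex.
Variables X Y : finType.
Implicit Types (F T : {set X * Y}) (e : X * Y) (u v : X + Y).
Implicit Types (I : {set X}) (J : {set Y}) (w : X * Y -> nat).

Record flow F (a : X -> nat) (b : Y -> nat) w : Prop := Flow {
  flow_supp : forall e, e \notin F -> w e = 0;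
  flow_row : forall x, \sum_y w (x, y) = a x;
  flow_col : forall y, \sum_x w (x, y) = b y }.

(** The combinatorial content of a triangulation by unimodular simplices:
    each nonzero lattice point of the cone over the root polytope has exactly one
    expression by natural multiples of the vertices of a simplex. *)
Record unimodular (K : {set X * Y} -> Prop) : Prop := Unimodular {
  um_acyclic : forall F, K F -> acyclic F;
  um_subset : forall F F', F' \subset F -> K F -> K F';
  um_uniq : forall F F' a b w w', K F -> K F' -> flow F a b w -> flow F' a b w' ->
    w =1 w';
  um_flow : forall a b, \sum_x a x = \sum_y b y -> 0 < \sum_x a x ->
    exists F w, K F /\ flow F a b w }.

(** An edge has both ends in C or neither, so its weight is counted on both
    sides or on none. *)
Lemma closed_balance F w (C : pred (X + Y)) :
  (forall e, e \notin F -> w e = 0) ->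
  (forall x y, (x, y) \in F -> C (inl x) = C (inr y)) ->
  \sum_(x | C (inl x)) \sum_y w (x, y) = \sum_(y | C (inr y)) \sum_x w (x, y).
Proof.
move=> wF CF; rewrite big_mkcond [RHS]big_mkcond /=.
under eq_bigr => x _ do rewrite -mulrb -sumrMnl.
under [RHS]eq_bigr => y _ do rewrite -mulrb -sumrMnl.
rewrite [RHS]exchange_big; apply: eq_bigr => x _; apply: eq_bigr => y _.
have [/CF->//|/wF->] := boolP ((x, y) \in F).
by rewrite !mul0rn.
Qed.

Variable K : {set X * Y} -> Prop.
Hypothesis umK : unimodular K.

(** By [matching_row] the subtraction does not truncate. *)
Lemma matching_flow I J T r : tree I J T -> r \in I ->
  flow T (fun x => degl T x + (x == r) - (x \in I)) (fun y => y \in J) (matching T r).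
Proof.
move=> tT rI; split=> [e|x|y]; first exact: matching0.
  by rewrite -(matching_row x tT rI) addnK.
exact: matching_col tT rI.
Qed.

(** The edge (r, j) belongs to the matching rooted at r, whose margins are
    given by the left degrees; uniqueness of flows puts it into the other tree
    as well. *)
Lemma tree_degl_inj I J T T' : tree I J T -> tree I J T' -> K T -> K T' ->
  degl T =1 degl T' -> T = T'.
Proof.
have sub S S' : tree I J S -> tree I J S' -> K S -> K S' -> degl S =1 degl S' ->
    S \subset S'.
  move=> tS tS' KS KS' dSS'; apply/subsetP => -[r j] eS.
  have [/= rI _] := andP (tree_sub tS eS).
  have [_ row col] := matching_flow tS' rI.
  have fS' : flow S' (fun x => degl S x + (x == r) - (x \in I)) (fun y => y \in J)
      (matching S' r).
    by split=> [e|x|y]; [apply: matching0 | rewrite dSS'; apply: row | apply: col].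
  have := um_uniq umK KS KS' (matching_flow tS rI) fS' (r, j).
  rewrite /matching eS (lside_left S (r, j)).
  by case: (_ \in S').
move=> tT tT' KT KT' dTT'; apply/eqP.
by rewrite eqEsubset !sub.
Qed.

(** The margins #|I| a + 1 and #|I| b are balanced on a component only if
    the number of its left vertices is divisible by #|I|; hence the support of
    their flow connects all of I and J.  Each edge of the support carries a
    positive weight, and the added units over one side of a cut number at most
    #|I|, so after division by #|I| they disappear from the cut inequality. *)
Lemma generic_tree I J (a : X -> nat) (b : Y -> nat) : I != set0 ->
  (forall x, x \notin I -> a x = 0) -> (forall y, (b y != 0) = (y \in J)) ->
  \sum_x a x + 1 = \sum_y b y ->
  exists T, [/\ K T, tree I J T & forall e, e \in T ->
    \sum_(y | lside T e (inr y)) b y <= \sum_(x | lside T e (inl x)) a x].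
Proof.
move=> I0 aI bJ ab; have I_gt0 : 0 < #|I| by rewrite card_gt0.
set m := #|I| in I_gt0 *.
(* The added units make the margins generic: they are 1 modulo m. *)
pose a' x := m * a x + (x \in I); pose b' y := m * b y.
have sa' : \sum_x a' x = m * \sum_y b y.
  by rewrite big_split /= sum_mem -big_distrr /= -ab mulnDr muln1.
have ab' : \sum_x a' x = \sum_y b' y by rewrite sa' big_distrr.
have [] := um_flow umK ab'; first by rewrite sa' -ab; nia.
move=> F [w [KF [wF wr wc]]].
pose T := [set e | w e != 0].
have sTF : T \subset F.
  by apply/subsetP => e; rewrite inE; apply: contraR => /wF ->.
have KT : K T by apply: um_subset KF.
have wT e : e \notin T -> w e = 0 by rewrite inE negbK => /eqP.
have acT := um_acyclic umK KT.
have le_row x y : w (x, y) <= a' x by rewrite -wr (bigD1 y) //= leq_addr.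
have le_col x y : w (x, y) <= b' y by rewrite -wc (bigD1 x) //= leq_addr.
have sT e : e \in T -> (e.1 \in I) && (e.2 \in J).
  case: e => x y; rewrite inE /= => wxy; apply/andP; split.
    apply: contraNT wxy => xI; have := le_row x y.
    by rewrite /a' aI // (negPf xI) muln0 leqn0.
  apply: contraNT wxy => yJ; have := le_col x y; rewrite /b'.
  by move: yJ; rewrite -bJ negbK => /eqP ->; rewrite muln0 leqn0.
have cI u x : verts I J u -> x \in I -> connect (badj T) u (inl x).
  move=> uV xI; set C := connect (badj T) u.
  have Ce x' y : (x', y) \in T -> C (inl x') = C (inr y).
    move=> eT; apply: same_connect_r; first exact: badj_csym.
    exact: connect1.
  have bal : \sum_(x | C (inl x)) a' x = \sum_(y | C (inr y)) b' y.
    under eq_bigr do rewrite -wr; under [RHS]eq_bigr do rewrite -wc.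
    exact: closed_balance wT Ce.
  (* The component of u has 0 or m left vertices in I; none is impossible. *)
  pose CI := [set x in I | C (inl x)].
  have cE : \sum_(x | C (inl x)) a' x = m * \sum_(x | C (inl x)) a x + #|CI|.
    rewrite big_split -big_distrr /=; congr (_ + _).
    rewrite -sum1dep_card big_mkcond [RHS]big_mkcond /=; apply: eq_bigr => x' _.
    by case: (C _); rewrite ?andbF ?andbT //; case: (_ \in _).
  have CIm : #|CI| <= m by apply/subset_leq_card/subsetP => x'; rewrite inE => /andP[].
  have [C0|CI0] := posnP #|CI|; last first.
    have : CI == I.
      rewrite eqEcard -/m; apply/andP; split.
        by apply/subsetP => x'; rewrite inE => /andP[].
      move: bal; rewrite cE -big_distrr /=.
      set A := \sum_(_ | _) _; set B := \sum_(_ | _) _ => E.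
      by apply: dvdn_leq; rewrite // -(dvdn_addr _ (dvdn_mulr A (dvdnn m))) E dvdn_mulr.
    by move/eqP/setP/(_ x); rewrite inE xI => /andP[].
  have CI0 x' : x' \in I -> C (inl x') = false.
    move=> x'I; apply: contraTF (eqxx #|CI|) => Cx'; rewrite {1}C0 eq_sym -lt0n.
    by apply/card_gt0P; exists x'; rewrite inE x'I.
  case: u @C uV => [x0|y0] C uV in Ce bal CI cE CIm C0 CI0 *.
    by have := CI0 x0 uV; rewrite /C connect0.
  move: bal; rewrite cE C0 big1; last first.
    by move=> x' Cx'; apply: aI; apply: contraTN Cx' => /CI0 ->.
  rewrite muln0 (bigD1 y0) /C ?connect0 //= /b'.
  by move: uV; rewrite /= -bJ; nia.
have cT u v : verts I J u -> verts I J v -> connect (badj T) u v.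
  have /set0Pn[x xI] := I0; move=> /cI /(_ xI) ux /cI /(_ xI) vx.
  by apply: connect_trans ux _; rewrite badj_csym.
exists T; split=> // e eT.
have : \sum_(x | lside T e (inl x)) \sum_y w (x, y) =
  \sum_(y | lside T e (inr y)) \sum_x w (x, y) + w e := cut_flow acT eT wT.
under eq_bigr do rewrite wr; under [in X in _ = X -> _]eq_bigr do rewrite wc.
rewrite big_split -!big_distrr /=.
have : \sum_(x | lside T e (inl x)) (x \in I) <= m.
  rewrite /m -sum_mem big_mkcond; apply: leq_sum => x _; by case: ifP.
have : 0 < w e by move: eT; rewrite inE lt0n.
move=> w0 cm E; rewrite -ltnS -(ltn_pmul2l I_gt0) -/m; move: E w0 cm.
rewrite mulnS; set p := \sum_(_ | _) _; set q := \sum_(_ | _) _; set r := \sum_(_ | _) _.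
lia.
Qed.

(** Apply [generic_tree] with all right margins equal to 1.  The flow of the
    cuts then has zero column sums, hence vanishes, and its row sums are the
    differences between v and the left degrees minus one. *)
Lemma tree_with_degl I J (v : X -> nat) : I != set0 ->
  (forall x, x \notin I -> v x = 0) -> \sum_x v x + 1 = #|J| ->
  exists T, [/\ K T, tree I J T & forall x, degl T x = v x + (x \in I)].
Proof.
move=> I0 vI vJ; have J0 : J != set0 by rewrite -card_gt0 -vJ addn1.
have [||T [KT tT cut]] := @generic_tree I J v (fun y => y \in J) I0 vI.
- by move=> y; case: (y \in J).
- by rewrite sum_mem.
exists T; split=> // x; have [xI|xI] := boolP (x \in I); last first.
  by rewrite (degl_eq0 tT xI) vI.
have [||w [w0 wr wc]] := flow_of_cuts (s := 1) tT J0 vI _ _ cut.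
- by move=> y /negPf ->.
- by rewrite sum_mem.
have := wr x xI; have := degl_gt0 tT xI J0; rewrite big1; first by lia.
move=> y _; have [yJ|yJ] := boolP (y \in J); last by rewrite w0 // (tree_notin _ tT).
by have := wc y yJ; rewrite yJ (bigD1 x) //=; lia.
Qed.

End Complex.

Section SwapComplex.
Variables X Y : finType.
Definition swap_complex (K : {set X * Y} -> Prop) (F : {set Y * X}) := K (swap F).

Lemma unimodular_swap (K : {set X * Y} -> Prop) :
  unimodular K -> unimodular (swap_complex K).
Proof.
move=> umK; have fl (F : {set Y * X}) a b w : flow F a b w ->
    flow (swap F) b a (fun e => w (e.2, e.1)).
  by case=> wF wr wc; split=> // -[x y]; rewrite inE; apply: wF.
split.
- move=> F KF [y x] eF; have := @um_acyclic _ _ _ umK _ KF (x, y); rewrite inE.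
  move=> /(_ eF); apply: contra; rewrite /lside badj_csym /= => xy.
  have -> : swap F :\ (x, y) = swap (F :\ (y, x)).
    by apply/setP => -[x' y']; rewrite !inE !xpair_eqE [(x' == x) && _]andbC.
  exact: (@connect_swap _ _ _ (inl x) (inr y)).
- move=> F F' /subsetP sFF'; apply: (um_subset umK); apply/subsetP => e.
  by rewrite !inE; apply: sFF'.
- move=> F F' a b w w' KF KF' /fl wF /fl wF' [y x].
  exact: (um_uniq umK KF KF' wF wF' (x, y)).
move=> a b ab a0; have [|F [w [KF [wF wr wc]]]] := um_flow umK (esym ab).
  by rewrite -ab.
exists (swap F), (fun e => w (e.2, e.1)); split; first by rewrite /swap_complex swapK.
by split=> // -[y x]; rewrite inE; apply: wF.
Qed.
End SwapComplex.

(** * Attaching a leaf *)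

Section Attach.
Variables X Y : finType.
Implicit Types (F T : {set X * Y}) (e : X * Y) (u v : X + Y).
Implicit Types (I : {set X}) (J : {set Y}) (w : X * Y -> nat).
Implicit Types (K : {set X * Y} -> Prop).

Lemma flow_add_leaf T i j a b w : flow T a b w ->
  flow ((i, j) |: T) (fun x => a x + (x == i)) (fun y => b y + (y == j))
    (fun e => w e + (e == (i, j))).
Proof.
case=> wT wr wc; split=> [e|x|y].
- by rewrite !inE negb_or => /andP[/negPf-> /wT->].
- rewrite big_split wr (bigD1 j) //= xpair_eqE eqxx andbT big1 ?addn0 // => y yj.
  by rewrite xpair_eqE (negPf yj) andbF.
rewrite big_split wc (bigD1 i) //= xpair_eqE eqxx big1 ?addn0 // => x xi.
by rewrite xpair_eqE (negPf xi).
Qed.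

(** The matching of T1 rooted at i2 together with (i1, j), and the matching
    of T2 rooted at k together with (i2, j), have the same margins, so they
    coincide. *)
Lemma attach_unique K I J T1 T2 j i1 i2 k : unimodular K ->
  tree I J T1 -> tree I J T2 -> j \notin J -> i2 \in I -> k \in I ->
  K ((i1, j) |: T1) -> K ((i2, j) |: T2) ->
  (forall x, degl T2 x + (x == k) = degl T1 x + (x == i1)) -> i1 = i2.
Proof.
move=> umK t1 t2 jJ i2I kI K1 K2 d12.
have f1 := flow_add_leaf i1 j (matching_flow t1 i2I).
have [s2 r2 c2] := flow_add_leaf i2 j (matching_flow t2 kI).
have f2 : flow ((i2, j) |: T2)
    (fun x => degl T1 x + (x == i2) - (x \in I) + (x == i1))
    (fun y => (y \in J) + (y == j))
    (fun e => matching T2 k e + (e == (i2, j))).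
  split=> // x; rewrite r2; have := matching_row x t1 i2I.
  by have := matching_row x t2 kI; have := d12 x; lia.
have := um_uniq umK K1 K2 f1 f2 (i1, j); rewrite !matching0 ?(tree_notin _ t1) //.
  by rewrite eqxx xpair_eqE eqxx andbT; case: eqP.
exact: tree_notin t2 _.
Qed.

(** There is a tree on (I, j |: J) with the right degrees of T and with j
    as a leaf; without the leaf it is T, by injectivity of right degrees. *)
Lemma exists_attach K I J T j : unimodular K -> tree I J T -> K T ->
  I != set0 -> J != set0 -> j \notin J ->
  exists2 i, i \in I & K ((i, j) |: T).
Proof.
move=> umK tT KT I0 J0 jJ; have tT' := tree_swap tT.
have umK' := unimodular_swap umK.
(* The value 0 of v at j makes j a leaf. *)
pose v y := degr T y - (y \in J).
have degr_ge y : (y \in J) <= degr T y.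
  by case yJ: (y \in J) => //; rewrite -degl_swap (degl_gt0 tT').
have vE : \sum_y v y + #|J| = \sum_y degr T y.
  by rewrite -sum_mem -big_split; apply: eq_bigr => y _; rewrite /= subnK.
have Jj0 : j |: J != set0 by apply/set0Pn; exists j; rewrite !inE eqxx.
have [||S [KS tS dS]] := @tree_with_degl _ _ _ umK' (j |: J) I v Jj0.
- move=> y; rewrite !inE negb_or => /andP[_ yJ].
  by rewrite /v (degr_eq0 tT yJ).
- have := edge_count tT' J0; under eq_bigr do rewrite degl_swap.
  by move: vE; lia.
have tS' := tree_swap tS; rewrite /swap_complex in KS.
have drS y : degr (swap S) y = v y + (y \in j |: J) by rewrite degr_swap.
have drj : degr (swap S) j = 1.
  by rewrite drS /v (degr_eq0 tT jJ) !inE eqxx.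
have [|i [T1 [iI t1 SE _]]] := tree_remove_leaf tS' _ drj; first by rewrite !inE eqxx.
rewrite setU1K // in t1.
exists i => //; suff <- : T1 = T by rewrite -SE.
apply: (can_inj (@swapK X Y)); apply: (tree_degl_inj umK' (tree_swap t1) tT').
- rewrite /swap_complex swapK; apply: (um_subset umK) KS; rewrite SE; exact: subsetUr.
- by rewrite /swap_complex swapK.
move=> y; rewrite !degl_swap; have := drS y.
rewrite SE degr_add_leaf; last by move=> x; apply: tree_notin t1 _.
rewrite !inE /v; have := degr_ge y.
by case: (eqVneq y j) => [->|_]; rewrite ?(negPf jJ) ?orTb ?orFb; lia.
Qed.

Definition degrees_in K K' I J := forall T, tree I J T -> K T ->
  exists T', [/\ tree I J T', K' T', degl T' =1 degl T & degr T' =1 degr T].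

Lemma degl_le I J T x : tree I J T -> degl T x <= #|J|.
Proof.
by move=> tT; apply/subset_leq_card/subsetP => y; rewrite inE => /(tree_sub tT)/andP[].
Qed.

Section Leaf.
Variables (K K' : {set X * Y} -> Prop) (I : {set X}) (J : {set Y}) (j : Y).
Hypotheses (umK : unimodular K) (umK' : unimodular K').
Hypotheses (I0 : I != set0) (J0 : J != set0) (jJ : j \notin J).
Hypothesis degK'K : degrees_in K' K I (j |: J).

(** The tree of K' has a partner in K with the same degrees, in which j is
    therefore a leaf too. *)
Lemma degrees_leaf T' k : tree I J T' -> k \in I -> K' ((k, j) |: T') ->
  exists i T, [/\ i \in I, tree I J T, K ((i, j) |: T),
    forall x, degl T x + (x == i) = degl T' x + (x == k) & degr T =1 degr T'].
Proof.
move=> tT' kI KT'; have [S [tS KS lS rS]] := degK'K (tree_add_leaf tT' kI jJ) KT'.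
have nT' x : (x, j) \notin T' := tree_notin x tT' jJ.
have drj : degr S j = 1.
  by rewrite rS degr_add_leaf // (degr_eq0 tT' jJ) eqxx.
have [|i [T [iI tT SE _]]] := tree_remove_leaf tS _ drj; first by rewrite !inE eqxx.
rewrite setU1K // in tT; have nT x : (x, j) \notin T := tree_notin x tT jJ.
exists i, T; split; rewrite -?SE // => z.
  by rewrite -!(degl_add_leaf _ _ (j := j)) // -SE.
by apply: (@addIn (z == j)); rewrite -(degr_add_leaf i) // -(degr_add_leaf k) // -SE.
Qed.

(** Transport from K to K' along left degrees, in order to compare where the
    two complexes attach j. *)
Lemma tree_same_degl T i : tree I J T -> i \in I -> K ((i, j) |: T) ->
  exists k T', [/\ k \in I, tree I J T', K' ((k, j) |: T') & degl T' =1 degl T].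
Proof.
move=> tT iI KT.
have [||T' [KT' tT' dT']] := @tree_with_degl _ _ _ umK' I J (fun x => degl T x - (x \in I)) I0.
- by move=> x xI; rewrite (degl_eq0 tT xI).
- have := edge_count tT I0; suff: \sum_x (degl T x - (x \in I)) + #|I| = \sum_x degl T x by lia.
  rewrite -sum_mem -big_split; apply: eq_bigr => x _; rewrite /= subnK //.
  by case xI: (x \in I) => //; apply: degl_gt0 tT xI J0.
have [k kI Kk] := exists_attach umK' tT' KT' I0 J0 jJ.
exists k, T'; split=> // x; rewrite dT' subnK //.
by case xI: (x \in I) => //; apply: degl_gt0 tT xI J0.
Qed.

(** Induction on how far the left degree at k is from its maximum.  If i
    and k differ, the partner T2 in K of the extended T' yields a tree of the
    same kind on which the complexes disagree again, with a larger degree at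
    k. *)
Lemma same_attach T T' i k : tree I J T -> tree I J T' -> i \in I -> k \in I ->
  K ((i, j) |: T) -> K' ((k, j) |: T') -> degl T =1 degl T' -> i = k.
Proof.
have [n] := ubnP (#|J| - degl T k).
elim: n => // n IHn in T T' i k * => le_n tT tT' iI kI KT KT' dTT'.
have [i2 [T2 [i2I tT2 KT2 lT2 _]]] := degrees_leaf tT' kI KT'.
have lT2' x : degl T2 x + (x == i2) = degl T x + (x == k) by rewrite lT2 dTT'.
have [i2k|i2k] := eqVneq i2 k.
  rewrite -i2k; apply: (attach_unique umK tT tT2 jJ i2I iI KT KT2) => x.
  by congr (_ + _); apply: (@addIn (x == k)); rewrite -{1}i2k lT2'.
have [k' [T2' [k'I tT2' KT2' dT2']]] := tree_same_degl tT2 i2I KT2.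
(* The vector of left degrees of T2 arises from that of T' by adding e_k and
   subtracting e_i2, so K' still attaches j at k. *)
have kk' : k = k'.
  apply: (attach_unique umK' tT' tT2' jJ k'I i2I KT' KT2') => x.
  by rewrite dT2' lT2' dTT'.
rewrite -kk' in KT2'.
case/eqP: (i2k); apply: (IHn T2 T2') => //.
have := lT2' k; rewrite eqxx [k == _]eq_sym (negPf i2k).
by have := degl_le k tT2; move: le_n; lia.
Qed.

(** The extension of T' by j has a partner in K; as both complexes attach
    j to the same vertex, removing j from the partner leaves the degrees of
    T'. *)
Lemma degrees_in_leaf : degrees_in K' K I J.
Proof.
move=> T' tT' KT'; have [k kI Kk] := exists_attach umK' tT' KT' I0 J0 jJ.
have [i [T [iI tT KT lT rT]]] := degrees_leaf tT' kI Kk.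
have [k' [S' [k'I tS' KS' dS']]] := tree_same_degl tT iI KT.
have ik' : i = k' by apply: (same_attach tT tS' iI k'I KT KS') => x; rewrite dS'.
have kk' : k = k'.
  by apply: (attach_unique umK' tT' tS' jJ k'I iI Kk KS') => x; rewrite dS' lT.
exists T; split=> //; first by apply: (um_subset umK) KT; apply: subsetUr.
by move=> x; apply: (@addIn (x == k)); rewrite -lT ik' kk'.
Qed.
End Leaf.

(** Every left vertex has positive degree, which leaves only the star. *)
Lemma tree_single I T j : tree I [set j] T -> T = [set e | (e.1 \in I) && (e.2 == j)].
Proof.
move=> tT; apply/setP => -[x y]; rewrite inE /=; apply/idP/andP.
  by move=> /(tree_sub tT); rewrite inE => /andP.
case=> xI /eqP->; have J0 : [set j] != set0 by apply/set0Pn; exists j; rewrite inE.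
have /card_gt0P[y'] := degl_gt0 tT xI J0; rewrite inE => xy'.
by have := tree_sub tT xy'; rewrite inE /= => /andP[_ /eqP <-].
Qed.

(** Otherwise all degrees are at least 2, which gives more than
    #|I| + #|J| - 1 edges. *)
Lemma exists_leaf I J T : tree I J T -> I != set0 -> J != set0 ->
  (exists2 i, i \in I & degl T i = 1) \/ (exists2 j, j \in J & degr T j = 1).
Proof.
move=> tT I0 J0.
have [/existsP[i /andP[iI /eqP d1]]|/existsPn noI] :=
  boolP [exists i, (i \in I) && (degl T i == 1)]; first by left; exists i.
have [/existsP[j /andP[jJ /eqP d1]]|/existsPn noJ] :=
  boolP [exists j, (j \in J) && (degr T j == 1)]; first by right; exists j.
have tT' := tree_swap tT.
have lI : 2 * #|I| <= \sum_x degl T x.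
  rewrite -sum_mem big_distrr; apply: leq_sum => x _ /=.
  have := noI x; case xI: (x \in I) => //=.
  by have := degl_gt0 tT xI J0; case: (degl T x) => [|[]].
have lJ : 2 * #|J| <= \sum_y degr T y.
  rewrite -sum_mem big_distrr; apply: leq_sum => y _ /=.
  have := noJ y; case yJ: (y \in J) => //=.
  by have := degl_gt0 tT' yJ I0; rewrite degl_swap; case: (degr T y) => [|[]].
have := edge_count tT I0; have := edge_count tT' J0.
under eq_bigr do rewrite degl_swap.
by move: lI lJ; lia.
Qed.

End Attach.

(** * Degrees determine the trees *)

Lemma degrees_in_swap (X Y : finType) (K K' : {set X * Y} -> Prop) I J :
  degrees_in K K' I J -> degrees_in (swap_complex K) (swap_complex K') J I.
Proof.
move=> deg T tT KT; have [T' [tT' KT' lT' rT']] := deg _ (tree_swap tT) KT.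
exists (swap T'); split; first exact: tree_swap; first by rewrite /swap_complex swapK.
  by move=> y; rewrite degl_swap rT' degr_swap.
by move=> x; rewrite degr_swap lT' degl_swap.
Qed.

(** Remove a leaf, apply the induction hypothesis to the rest, and attach
    the leaf again: the complexes agree on where. *)
Lemma degrees_determine_trees (X Y : finType) (K K' : {set X * Y} -> Prop) (I : {set X})
    (J : {set Y}) T :
  unimodular K -> unimodular K' -> I != set0 -> J != set0 ->
  degrees_in K K' I J -> degrees_in K' K I J -> tree I J T -> K T -> K' T.
Proof.
have [n] := ubnP (#|I| + #|J|).
elim: n => // n IHn in X Y K K' I J T * => le_n umK umK' I0 J0 d d' tT KT.
(* The types vary because a left leaf is treated by exchanging the sides. *)
have byleaf (X1 Y1 : finType) (L L' : {set X1 * Y1} -> Prop) (I1 : {set X1})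
      (J1 : {set Y1}) S j :
    #|I1| + #|J1| < n.+1 -> unimodular L -> unimodular L' -> I1 != set0 ->
    degrees_in L L' I1 J1 -> degrees_in L' L I1 J1 -> tree I1 J1 S -> L S ->
    j \in J1 -> degr S j = 1 -> L' S.
  move=> {}le_n umL umL' I10 e e' tS LS jJ1 dj.
  have [i [S1 [iI tS1 SE jJ2]]] := tree_remove_leaf tS jJ1 dj.
  have J1E : j |: J1 :\ j = J1 by rewrite setD1K.
  have [J20|J2n0] := eqVneq (J1 :\ j) set0.
    have J1j : J1 = [set j] by rewrite -J1E J20 setU0.
    have [S' [tS' LS' _ _]] := e S tS LS.
    by rewrite J1j in tS tS'; rewrite (tree_single tS) -(tree_single tS').
  have LS1 : L S1 by apply: (um_subset umL) LS; rewrite SE subsetUr.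
  rewrite -J1E in e e'.
  have L'S1 : L' S1.
    apply: (IHn _ _ L L' I1 (J1 :\ j)) => //; last 2 first.
    - exact: degrees_in_leaf umL' umL I10 J2n0 jJ2 e.
    - exact: degrees_in_leaf umL umL' I10 J2n0 jJ2 e'.
    by move: le_n; rewrite (cardsD1 j J1) jJ1; lia.
  have [k kI L'k] := exists_attach umL' tS1 L'S1 I10 J2n0 jJ2.
  rewrite SE in LS *.
  by rewrite (same_attach umL umL' I10 J2n0 jJ2 e' tS1 tS1 iI kI LS L'k).
have [[i iI di]|[j jJ dj]] := exists_leaf tT I0 J0; last exact: (byleaf X Y K K' I J T j).
rewrite -[T]swapK; apply: (byleaf _ _ (swap_complex K) (swap_complex K') J I _ i) => //.
- by rewrite addnC.
- exact: unimodular_swap.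
- exact: unimodular_swap.
- exact: degrees_in_swap.
- exact: degrees_in_swap.
- exact: tree_swap.
- by rewrite /swap_complex swapK.
- by rewrite degr_swap.
Qed.

(** Move a large multiple of the point with margins deg F in a generic
    direction.  The tree that contains the moved point satisfies the cut
    inequalities for deg F too, so deg F has a flow on that tree; by uniqueness
    it is the indicator function of F. *)
Lemma face_of_tree (X Y : finType) (K : {set X * Y} -> Prop) F (x0 : X) (y0 : Y) :
  unimodular K -> K F -> exists T, [/\ K T, tree [set: X] [set: Y] T & F \subset T].
Proof.
move=> umK KF; set N := #|Y|.
have N0 : 0 < N by apply/card_gt0P; exists y0.
have X0 : [set: X] != set0 by apply/set0Pn; exists x0; rewrite inE.
have Y0 : [set: Y] != set0 by apply/set0Pn; exists y0; rewrite inE.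
have dF : \sum_x degl F x = \sum_y degr F y.
  under eq_bigr do rewrite degl_sum; under [RHS]eq_bigr do rewrite degr_sum.
  exact: exchange_big.
(* The perturbation ((N - 1) e_x0, 1) changes each cut by less than N. *)
pose a x := N * degl F x + (x == x0) * N.-1; pose b y := N * degr F y + 1.
have [|||T [KT tT cut]] := @generic_tree _ _ _ umK setT setT a b X0.
- by move=> x; rewrite inE.
- by move=> y; rewrite inE /b addn1.
- rewrite !big_split -!big_distrr -big_distrl /= dF sum1_card -/N.
  have -> : \sum_x (x == x0 : nat) = 1.
    by rewrite (bigD1 x0) //= eqxx big1 // => x /negPf ->.
  by rewrite mul1n -addnA addn1 prednK.
exists T; split=> //.
have [||||w [w0 wr wc]] := @flow_of_cuts _ _ _ _ T (degl F) (degr F) 0 tT Y0.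
- by move=> x; rewrite inE.
- by move=> y; rewrite inE.
- by rewrite addn0.
- move=> e /cut; rewrite !big_split -!big_distrr -big_distrl /=.
  set p := \sum_(_ | _) degr _ _; set q := \sum_(_ | _) degl _ _.
  have : \sum_(x | lside T e (inl x)) (x == x0 : nat) <= 1.
    rewrite big_mkcond (bigD1 x0) //= big1 ?addn0 ?eqxx; first by case: ifP.
    by move=> x /negPf ->; case: ifP.
  set r := \sum_(_ | _) _; set s := \sum_(_ | _) _ => r1 le.
  rewrite -ltnS -(ltn_pmul2l N0) mulnS; move: le r1; clearbody p q r s; nia.
have fF : flow F (degl F) (degr F) (fun e => e \in F).
  split=> [e /negPf->//|x|y]; first by rewrite degl_sum.
  by rewrite degr_sum.
have fT : flow T (degl F) (degr F) w.
  split=> // [x|y]; first by rewrite -(wr x) ?inE // mul0n addn0.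
  by rewrite -(wc y) ?inE // addn0.
apply/subsetP => e eF; have := um_uniq umK KF KT fF fT e; rewrite eF.
by apply: contraPT => /w0 ->.
Qed.

(** * The unimodular complex of a triangulation *)

Section Geometry.
Variables (R : realType) (m n : nat).
Implicit Types (F T : bigraph m n) (e : 'I_m * 'I_n) (x : 'rV[R]_(m + n)).
Local Open Scope ring_scope.

Lemma forest_acyclic F : forest F -> acyclic F.
Proof.
move=> forF [i j] eF; apply/negP => /connectP[p0].
case/shortenP=> p ip uip _ {p0} /= jE.
have: ucycle (adj F) (inl i :: p).
  rewrite /ucycle uip andbT /= rcons_path -jE /= eF andbT.
  apply: sub_path ip => -[i'|j'] [i''|j''] //=; rewrite !inE => /andP[_] //.
move=> /forF /=; case: p ip jE {uip} => [|z [|//]] //= + jE _.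
by rewrite -jE /= !inE eqxx.
Qed.

Lemma root_vectorE e : (forall i, root_vector R e 0 (lshift n i) = (e.1 == i)%:R) /\
  (forall j, root_vector R e 0 (rshift m j) = - (e.2 == j)%:R).
Proof.
split=> k; rewrite !mxE /= ?eq_lshift ?eq_rshift ?eq_lrshift ?eq_rlshift.
  by rewrite subr0 eq_sym.
by rewrite sub0r eq_sym.
Qed.

Lemma root_sumE (w : 'I_m * 'I_n -> R) :
  (forall i, (\sum_e w e *: root_vector R e) 0 (lshift n i) = \sum_j w (i, j)) /\
  (forall j, (\sum_e w e *: root_vector R e) 0 (rshift m j) =
             - \sum_i w (i, j)).
Proof.
split=> k; rewrite summxE.
  under eq_bigr => e _ do rewrite mxE (root_vectorE e).1.
  transitivity (\sum_i \sum_j w (i, j) * (i == k)%:R).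
    by rewrite pair_bigA; apply: eq_bigr => -[].
  rewrite (bigD1 k) //= [X in _ + X]big1 ?addr0.
    by apply: eq_bigr => j _; rewrite eqxx mulr1.
  by move=> i /negPf ne; apply: big1 => j _; rewrite ne mulr0.
under eq_bigr => e _ do rewrite mxE (root_vectorE e).2.
transitivity (\sum_i \sum_j w (i, j) * - (j == k)%:R).
  by rewrite pair_bigA; apply: eq_bigr => -[].
rewrite -sumrN; apply: eq_bigr => i _; rewrite (bigD1 k) //= [X in _ + X]big1 ?addr0.
  by rewrite eqxx mulrN mulr1.
by move=> j /negPf ne; rewrite ne oppr0 mulr0.
Qed.

(** Membership in a simplex is a transportation problem with real weights,
    the form to which [cut_flow] applies. *)
Lemma DeltaP F x : Delta R F x <-> exists w : 'I_m * 'I_n -> R,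
  [/\ forall e, 0 <= w e, forall e, e \notin F -> w e = 0, \sum_e w e = 1,
      forall i, \sum_j w (i, j) = x 0 (lshift n i) &
      forall j, \sum_i w (i, j) = - x 0 (rshift m j)].
Proof.
have sumF (V : zmodType) (v : 'I_m * 'I_n -> V) :
    (forall e, e \notin F -> v e = 0) -> \sum_e v e = \sum_(e in F) v e.
  by move=> vF; rewrite (bigID (mem F)) /= [X in _ + X]big1 ?addr0.
split=> [[w [w0 w1 xE]]|[w [w0 wF w1 wr wc]]].
  pose w' e := if e \in F then w e else 0.
  have w'F e : e \notin F -> w' e = 0 by rewrite /w' => /negPf->.
  have {}xE : x = \sum_e w' e *: root_vector R e.
    rewrite xE sumF => [|e /w'F->]; last by rewrite scale0r.
    by apply: eq_bigr => e eF; rewrite /w' eF.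
  exists w'; rewrite xE; split=> //.
  - by move=> e; rewrite /w'; case: ifP => // /w0.
  - by rewrite -w1 [RHS]big_mkcond.
  - by move=> i; rewrite (root_sumE w').1.
  - by move=> j; rewrite (root_sumE w').2 opprK.
exists w; split=> //; first by rewrite -w1 sumF.
rewrite -sumF => [|e /wF->]; last by rewrite scale0r.
apply/rowP => k; rewrite -[k]splitK; case: (split k) => [i|j] /=.
  by rewrite (root_sumE w).1 wr.
by rewrite (root_sumE w).2 wc opprK.
Qed.

Lemma acyclic_flow_uniq F (w w' : 'I_m * 'I_n -> R) : acyclic F ->
  (forall e, e \notin F -> w e = 0) -> (forall e, e \notin F -> w' e = 0) ->
  (forall i, \sum_j w (i, j) = \sum_j w' (i, j)) ->
  (forall j, \sum_i w (i, j) = \sum_i w' (i, j)) -> w =1 w'.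
Proof.
move=> acF wF wF' wr wc e; have [eF|eF] := boolP (e \in F); last by rewrite wF ?wF'.
have := cut_flow acF eF wF; under eq_bigr do rewrite wr.
under [in X in _ = X -> _]eq_bigr do rewrite wc.
by rewrite (cut_flow acF eF wF') => /addrI.
Qed.

(** The point of the root polytope on the ray through (a, -b). *)
Definition margin_point (a : 'I_m -> nat) (b : 'I_n -> nat) : 'rV[R]_(m + n) :=
  let N := (\sum_i a i)%N%:R in
  row_mx (\row_i ((a i)%:R / N)) (\row_j (- (b j)%:R / N)).

Lemma margin_pointE a b :
  (forall i, margin_point a b 0 (lshift n i) = (a i)%:R / (\sum_i a i)%N%:R) /\
  (forall j, margin_point a b 0 (rshift m j) = - ((b j)%:R / (\sum_i a i)%N%:R)).
Proof. by split=> k; rewrite ?row_mxEl ?row_mxEr mxE ?mulNr. Qed.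

Lemma Delta_margin_point F a b w : (0 < \sum_i a i)%N -> flow F a b w ->
  Delta R F (margin_point a b).
Proof.
move=> N0 [wF wr wc]; set N := (\sum_i a i)%N in N0.
have NR : N%:R != 0 :> R by rewrite pnatr_eq0 -lt0n.
apply/DeltaP; exists (fun e => (w e)%:R / N%:R); split.
- by move=> e; rewrite divr_ge0.
- by move=> e /wF->; rewrite mul0r.
- rewrite -big_distrl /= -natr_sum -[X in X%:R / _](_ : N = _) ?divff //.
  rewrite /N; under eq_bigr do rewrite -wr.
  by rewrite pair_bigA; apply: eq_bigr => -[].
- by move=> i; rewrite (margin_pointE _ _).1 -big_distrl /= -natr_sum wr.
- by move=> j; rewrite (margin_pointE _ _).2 opprK -big_distrl /= -natr_sum wc.
Qed.

Section Tau.
Variable tau : set (set 'rV[R]_(m + n)).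
Hypothesis triTau : triangulation tau.

Definition face F : Prop := forest F /\ tau (Delta R F).

Lemma forest_subset F F' : F' \subset F -> forest F -> forest F'.
Proof.
move=> /subsetP sF forF p /andP[cp up]; apply: forF; rewrite /ucycle up andbT.
by apply: sub_cycle cp => -[i|j] [i'|j'] //= /sF.
Qed.

(** The common point lies in the simplex of F :&: F', and its weights there
    are its only weights on F and on F'. *)
Lemma face_uniq F F' a b w w' : face F -> face F' -> flow F a b w ->
  flow F' a b w' -> w =1 w'.
Proof.
move=> [forF tF] [forF' tF'] fw fw'; have [wF wr wc] := fw; have [wF' wr' wc'] := fw'.
have [N0|Npos] := posnP (\sum_i a i)%N.
  have a0 i : a i = 0%N by move/eqP: N0; rewrite sum_nat_eq0 => /forallP/(_ i)/eqP.
  move=> [i j]; have /eqP := wr i; have /eqP := wr' i; rewrite a0 !sum_nat_eq0.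
  by move=> /forallP/(_ j)/eqP-> /forallP/(_ j)/eqP->.
have NR : (\sum_i a i)%N%:R != 0 :> R by rewrite pnatr_eq0 -lt0n.
have : (Delta R F `&` Delta R F')%classic (margin_point a b).
  by split; [apply: Delta_margin_point fw | apply: Delta_margin_point fw'].
rewrite (tri_inter triTau) // => /DeltaP[u [_ uF _ ur uc]].
have key G v : forest G -> F :&: F' \subset G -> flow G a b v ->
    forall e, (v e)%:R / (\sum_i a i)%N%:R = u e.
  move=> forG /subsetP sG [vG vr vc].
  apply: (acyclic_flow_uniq (forest_acyclic forG)) => [e|e|i|j].
  - by move=> /vG->; rewrite mul0r.
  - by move=> eG; apply: uF; apply: contra eG => /sG.
  - by rewrite -big_distrl /= -natr_sum vr ur (margin_pointE _ _).1.
  - by rewrite -big_distrl /= -natr_sum vc uc (margin_pointE _ _).2 opprK.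
move=> e; apply/eqP; rewrite -(eqr_nat R); apply/eqP/(mulIf (invr_neq0 NR)).
by rewrite (key F w) ?(key F' w') ?subsetIl ?subsetIr.
Qed.

(** The product weights put the point in the root polytope.  Its weights on
    a forest that covers it become natural numbers after scaling, by
    [cut_flow]. *)
Lemma face_flow (a : 'I_m -> nat) (b : 'I_n -> nat) :
  (\sum_i a i = \sum_j b j -> 0 < \sum_i a i ->
  exists F w, face F /\ flow F a b w)%N.
Proof.
move=> ab Npos; set N := (\sum_i a i)%N in ab Npos.
have NR : N%:R != 0 :> R by rewrite pnatr_eq0 -lt0n.
have Na : \sum_i (a i)%:R = N%:R :> R by rewrite natr_sum.
have Nb : \sum_j (b j)%:R = N%:R :> R by rewrite ab natr_sum.
have : root_polytope R m n (margin_point a b).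
  apply/DeltaP; exists (fun e => (a e.1)%:R / N%:R * ((b e.2)%:R / N%:R)).
  have sb : \sum_j (b j)%:R / N%:R = 1 :> R by rewrite -big_distrl /= Nb divff.
  have sa : \sum_i (a i)%:R / N%:R = 1 :> R by rewrite -big_distrl /= Na divff.
  split.
  - by move=> e; rewrite mulr_ge0 ?divr_ge0.
  - by move=> e; rewrite inE.
  - transitivity (\sum_i \sum_j (a i)%:R / N%:R * ((b j)%:R / N%:R) : R).
      by rewrite pair_bigA; apply: eq_bigr => -[].
    by under eq_bigr => i _ do rewrite -big_distrr /= sb mulr1.
  - by move=> i /=; rewrite (margin_pointE _ _).1 -big_distrr /= sb mulr1.
  - by move=> j /=; rewrite (margin_pointE _ _).2 opprK -big_distrl /= sa mul1r.
rewrite -(tri_cover triTau) => -[s ts sx].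
have [F forF sE] := tri_forest triTau ts; rewrite sE in ts sx.
have [u [u0 uF _ ur uc]] := (DeltaP _ _).1 sx.
have acF := forest_acyclic forF.
pose A e := (\sum_(i | lside F e (inl i)) a i)%N.
pose B e := (\sum_(j | lside F e (inr j)) b j)%N.
have cut e : e \in F -> (A e)%:R = (B e)%:R + N%:R * u e.
  move=> eF; have := cut_flow acF eF uF; under eq_bigr do rewrite ur.
  under [in X in _ = X -> _]eq_bigr do rewrite uc.
  under eq_bigr do rewrite (margin_pointE _ _).1.
  under [in X in _ = X -> _]eq_bigr do rewrite (margin_pointE _ _).2 opprK.
  rewrite -!big_distrl /= -!natr_sum => /(congr1 ( *%R N%:R)).
  by rewrite mulrDr ![N%:R * (_ / _)]mulrC !divfK.
pose w e := if e \in F then (A e - B e)%N else 0%N.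
have wE e : (w e)%:R = N%:R * u e.
  rewrite /w; case: ifP => [eF|/negbT/uF->]; last by rewrite mulr0.
  have := cut e eF; rewrite natrB => [->|]; first by rewrite addrC addKr.
  by rewrite -(ler_nat R) cut // lerDl mulr_ge0.
exists F, w; split=> //; split=> [e /negPf eF|i|j]; first by rewrite /w eF.
  apply/eqP; rewrite -(eqr_nat R) natr_sum; under eq_bigr do rewrite wE.
  by rewrite -big_distrr /= ur (margin_pointE _ _).1 mulrC divfK.
apply/eqP; rewrite -(eqr_nat R) natr_sum; under eq_bigr do rewrite wE.
by rewrite -big_distrr /= uc (margin_pointE _ _).2 opprK mulrC divfK.
Qed.

Lemma unimodular_face : unimodular face.
Proof.
split; [|move=> F F' sF [forF tF]|exact: face_uniq|exact: face_flow].
  by move=> F [/forest_acyclic].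
by split; [apply: forest_subset forF | apply: (tri_face triTau) tF _].
Qed.

Lemma treesP T : trees tau T <-> face T /\ tree [set: 'I_m] [set: 'I_n] T.
Proof.
split=> [[[forT cT] tT]|[[forT tT] [_ _ cT]]]; last first.
  by split=> //; split=> // u v; apply: cT; [case: u | case: v] => k; apply: in_setT.
split=> //; split=> [|e _|u v _ _]; rewrite ?inE //; first exact: forest_acyclic.
exact: cT.
Qed.

End Tau.

End Geometry.

(** * Degree vectors and phi *)

Lemma ord_setT_neq0 n : (0 < n)%N -> [set: 'I_n] != set0.
Proof. by move=> n0; rewrite -card_gt0 cardsT card_ord. Qed.

(** The set counted by [ldeg] is a predicate in Prop, the one counted by [degl] a
    finite set. *)
Lemma ldegE m n (T : bigraph m n) i : ldeg T i = degl T i.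
Proof.
by apply: eq_card => j; rewrite [RHS]inE; apply/idP/idP => [/set_mem|/mem_set].
Qed.

Lemma rdegE m n (T : bigraph m n) j : rdeg T j = degr T j.
Proof.
by apply: eq_card => i; rewrite [RHS]inE; apply/idP/idP => [/set_mem|/mem_set].
Qed.

Lemma LD_degl m n (T : bigraph m n) i : (0 < n)%N ->
  tree [set: 'I_m] [set: 'I_n] T -> (LD T i).+1 = degl T i.
Proof.
move=> n0 tT; rewrite ffunE ldegE prednK //.
by apply: (degl_gt0 tT _ (ord_setT_neq0 n0)); rewrite inE.
Qed.

Lemma LD_sum m n (T : bigraph m n) : (0 < m)%N -> (0 < n)%N ->
  tree [set: 'I_m] [set: 'I_n] T -> (\sum_i LD T i == n.-1)%N.
Proof.
move=> m0 n0 tT; have := edge_count tT (ord_setT_neq0 m0).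
under eq_bigr => i _ do rewrite -(LD_degl i n0 tT) -addn1.
rewrite big_split /= sum_nat_const muln1 !cardsT !card_ord => E.
rewrite -eqSS (prednK n0) -(eqn_add2r m) -addn1 addnAC [(n + m)%N]addnC.
by rewrite -E.
Qed.

Lemma RD_LD_swap m n (T : bigraph m n) : RD T = LD (swap T).
Proof. by apply/ffunP => j; rewrite !ffunE rdegE ldegE degl_swap. Qed.

Definition lattice_point k d (v : {ffun 'I_k -> nat}) (vd : \sum_i v i == d) :
  lattice_simplex k d := exist _ v vd.

Section Phi.
Variables (R : realType) (m n : nat) (m0 : (0 < m)%N) (n0 : (0 < n)%N).
Implicit Types (tau : set (set 'rV[R]_(m + n))) (T : bigraph m n).

(** The tree behind a value of phi is unique because left degrees determine
    trees. *)
Lemma phi_tree tau T (v : lattice_simplex m n.-1) : triangulation tau ->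
  trees tau T -> LD T = val v -> val (phi n0 tau v) = RD T.
Proof.
move=> triTau trT LDT; have [KT tT] := (treesP _ _).1 trT.
have RT : (\sum_j RD T j == m.-1)%N.
  by rewrite RD_LD_swap; apply: LD_sum => //; apply: tree_swap.
have /(xgetPex (corner m.-1 n0)) : exists w : lattice_simplex n m.-1,
    exists T : bigraph m n, [/\ trees tau T, LD T = val v & RD T = val w].
  by exists (lattice_point RT), T.
case=> T' [trT' LDT' RDT']; rewrite [LHS](_ : _ = RD T') //.
have [KT' tT'] := (treesP _ _).1 trT'.
congr RD; apply: (tree_degl_inj (unimodular_face triTau) tT' tT KT' KT) => i.
by rewrite -(LD_degl i n0 tT') -(LD_degl i n0 tT) LDT LDT'.
Qed.

Lemma phi_degrees_in tau tau' : triangulation tau -> triangulation tau' ->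
  phi n0 tau = phi n0 tau' ->
  degrees_in (face tau) (face tau') [set: 'I_m] [set: 'I_n].
Proof.
move=> triTau triTau' phiE T tT KT.
pose v := lattice_point (LD_sum m0 n0 tT).
have [||T' [KT' tT' dT']] := tree_with_degl (unimodular_face triTau') (J := [set: 'I_n])
    (v := LD T) (ord_setT_neq0 m0).
- by move=> i; rewrite inE.
- by rewrite cardsT card_ord (eqP (LD_sum m0 n0 tT)) addn1 prednK.
have dlE : degl T' =1 degl T by move=> i; rewrite dT' inE addn1 (LD_degl i n0 tT).
have LDE : LD T' = LD T by apply/ffunP => i; rewrite !ffunE !ldegE dlE.
exists T'; split=> // j.
have RDT : val (phi n0 tau v) = RD T by apply: phi_tree => //; apply/treesP.
have RDT' : val (phi n0 tau' v) = RD T' by apply: phi_tree => //; apply/treesP.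
have tS := tree_swap tT; have tS' := tree_swap tT'.
rewrite -!degl_swap -(LD_degl j m0 tS) -(LD_degl j m0 tS') -!RD_LD_swap.
by rewrite -RDT -RDT' phiE.
Qed.
End Phi.

Theorem theorem3p7 (R : realType) (m n : nat) (m_gt0 : (0 < m)%N)
    (n_gt0 : (0 < n)%N) (tau tau' : set (set 'rV[R]_(m + n))) :
  triangulation tau -> triangulation tau' -> tau <> tau' ->
  phi n_gt0 tau <> phi n_gt0 tau'.
Proof.
move=> triTau triTau' tauE phiE; apply: tauE.
have incl (t t' : set (set 'rV[R]_(m + n))) : triangulation t -> triangulation t' ->
    phi n_gt0 t = phi n_gt0 t' -> (t `<=` t')%classic.
  move=> tri tri' E s ts; have [F forF sE] := tri_forest tri ts.
  have um := unimodular_face tri; have um' := unimodular_face tri'.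
  have KF : face t F by split; rewrite -?sE.
  have [T [KT tT sFT]] := face_of_tree (Ordinal m_gt0) (Ordinal n_gt0) um KF.
  have [_ tT'] : face t' T.
    apply: degrees_determine_trees um um' (ord_setT_neq0 m_gt0) (ord_setT_neq0 n_gt0) _ _ tT KT.
      exact: phi_degrees_in.
    exact: phi_degrees_in (esym E).
  by rewrite sE; apply: (tri_face tri') tT' sFT.
by apply/seteqP; split; apply: incl.
Qed.
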